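(* Let $k$ be a positive integer. There exists an integer $n_0$ such that if $n \geq \max\{(80k)^2, n_0\}$ and $G$ is an $n$-vertex graph not containing $C_n^k$ as a subgraph, then $\lambda(G) \leq \lambda(H_{n,2k})$, with equality if and only if $G \cong H_{n,2k}$.
   Context: All graphs are finite and simple. $\lambda(G)$ denotes the largest eigenvalue of the adjacency matrix of $G$. $C_n^k$ is the $k$-th power of the $n$-vertex cycle $C_n$: the graph on $V(C_n)$ in which two vertices are adjacent iff their distance in $C_n$ is at most $k$. For integers $n>m\geq 1$, $H_{n,m} = K_{m-1} \vee (K_{n-m} \cup K_1)$, i.e. an $(n-1)$-clique plus one vertex adjacent to exactly $m-1$ vertices of the clique. *)

(* Defs.v *)
From HB Require Import structures.
From mathcomp Require Import all_boot all_order all_algebra.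
From mathcomp Require Import reals.
Set Implicit Arguments. Unset Strict Implicit. Unset Printing Implicit Defensive.
Import Order.TTheory GRing.Theory Num.Theory.

Definition simple_graph n (e : rel 'I_n) : Prop := symmetric e /\ irreflexive e.

Definition adjmx (R : realType) n (e : rel 'I_n) : 'M[R]_n :=
  \matrix_(i, j) ((e i j)%:R)%R.

Definition largest_eigenvalue (R : realType) n (A : 'M[R]_n) (l : R) : Prop :=
  eigenvalue A l /\ (forall mu : R, eigenvalue A mu -> (mu <= l)%R).

Definition cycdist n (i j : 'I_n) : nat :=
  let d := (maxn i j - minn i j)%N in minn d (n - d).

Definition cycle_pow n k : rel 'I_n :=
  fun i j => (0 < cycdist i j <= k)%N.

(* H_{n,m} = K_{m-1} v (K_{n-m} u K_1): vertex n-1 is the extra vertex,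
   adjacent exactly to vertices 0..m-2; all other pairs are adjacent. *)
Definition Hgraph n m : rel 'I_n :=
  fun i j => (i != j) &&
    ((((i : nat) != n.-1) && ((j : nat) != n.-1)) || (minn i j < m.-1)%N).

Definition contains_subgraph n (G F : rel 'I_n) : Prop :=
  exists f : 'I_n -> 'I_n, injective f /\ forall i j, F i j -> G (f i) (f j).

Definition graph_iso n (G F : rel 'I_n) : Prop :=
  exists f : 'I_n -> 'I_n, bijective f /\ forall i j, G i j = F (f i) (f j).

(* Main.v *)
Require Import Defs.
From HB Require Import structures.
From mathcomp Require Import all_classical reals topology normedtype derive.
From mathcomp Require Import all_boot all_order all_algebra all_fingroup.
From mathcomp Require Import zify ring lra.
Set Implicit Arguments. Unset Strict Implicit. Unset Printing Implicit Defensive.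
Import Order.TTheory GRing.Theory Num.Theory.

(** Write F for the complement of G, d for degrees in F, and suppose that
    lambda(G) >= lambda(H_{n,2k}); the latter is at least n - 2 because H_{n,2k}
    contains K_{n-1}.

    If some vertex has degree less than 2k in G, then G is a relabelled
    subgraph of H_{n,2k}.  Evaluating the Rayleigh quotient of H_{n,2k} at the
    Perron vector of G gives lambda(G) <= lambda(H_{n,2k}); in case of equality
    that vector is a positive eigenvector of H_{n,2k}, so no edge is missing.

    Otherwise d(v) <= n - 1 - 2k for all v, and C_n^k embeds in G, i.e. it can be
    placed so as to avoid F.  Expressing A(G) = J - I - F in the eigenvalue
    equation shows that lambda(G) >= n - 2 forces
    sum_v d(v) (n - 1 - d(v)) <= (n - 1)^2.  Hence either F has O(n) edges and
    boundedly many vertices of linear degree, or a single vertex u dominates F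
    and F has at least 2k isolated vertices.  In both cases the vertices of large
    F-degree can be put in the middle of windows of 2k + 1 consecutive positions
    free of conflicts; in an arrangement extending these windows with the fewest
    conflicts there is no conflict, since a vertex outside the windows can be
    swapped away without creating a new one. *)

(** * Avoiding a sparse graph by a bounded-degree graph *)

Definition deg n (F : rel 'I_n) (v : 'I_n) := #|[set w | F v w]|.

Lemma cycle_pow_sym n k : symmetric (@cycle_pow n k).
Proof. by move=> i j; rewrite /cycle_pow /cycdist [maxn i j]maxnC [minn i j]minnC. Qed.

Lemma cycle_pow_irr n k : irreflexive (@cycle_pow n k).
Proof. by move=> i; rewrite /cycle_pow /cycdist maxnn minnn subnn min0n. Qed.

(** Every neighbour of [i] is [i + t] or [i - t] modulo [n] for some [t] from 1 to [k]; the list [s]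
    has [2 * k] entries, possibly with repetitions. *)
Lemma deg_cycle_pow n k (i : 'I_n) : deg (@cycle_pow n k) i <= 2 * k.
Proof.
pose s := [seq (i + t) %% n | t <- iota 1 k] ++
          [seq (i + n - t) %% n | t <- iota 1 k].
have sz : size s = 2 * k by rewrite size_cat !size_map !size_iota; lia.
rewrite -sz /deg cardE -(size_map val).
apply: uniq_leq_size; first by rewrite map_inj_uniq ?enum_uniq //; exact: val_inj.
move=> _ /mapP[j jin ->]; move: jin.
rewrite mem_enum inE /cycle_pow /cycdist mem_cat => jn.
have [li lj] := (ltn_ord i, ltn_ord j).
case: (ltnP i j) => ij; case: (leqP (maxn i j - minn i j) k) => dk.
- apply/orP; left; apply/mapP; exists (j - i); rewrite ?mem_iota; [lia|].
  by rewrite subnKC ?(ltnW ij) // modn_small.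
- apply/orP; right; apply/mapP; exists (n - (j - i)); rewrite ?mem_iota; [lia|].
  by rewrite (_ : i + n - _ = j) ?modn_small //=; lia.
- apply/orP; right; apply/mapP; exists (i - j); rewrite ?mem_iota; [lia|].
  by rewrite (_ : i + n - _ = j + n) ?modnDr ?modn_small //=; lia.
- apply/orP; left; apply/mapP; exists (n - (i - j)); rewrite ?mem_iota; [lia|].
  by rewrite (_ : i + _ = j + n) ?modnDr ?modn_small //=; lia.
Qed.

Lemma card_bigcup_leq (T I : finType) (A : {set I}) (B : I -> {set T}) b :
  (forall i, i \in A -> #|B i| <= b) -> #|\bigcup_(i in A) B i| <= #|A| * b.
Proof.
move=> Bb; rewrite -sum_nat_const.
apply: (@leq_trans (\sum_(i in A) #|B i|)); last exact: leq_sum.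
elim/big_rec2: _ => [|i m X _ IH]; first by rewrite cards0.
by rewrite (leq_trans (leq_card_setU _ _)) // leq_add2l.
Qed.

(** The first [T] positions are frozen as in [f0]; they contain every vertex of large F-degree
    together with the positions adjacent to it. The factor 8 keeps each of [A3] and [A4] below
    [n / 4], so that the bound on [T + 1 + D] leaves a position to swap with. *)
Lemma packing_extend n (c F : rel 'I_n) D T (f0 : {perm 'I_n}) :
  symmetric c -> irreflexive c -> symmetric F ->
  (forall i, deg c i <= D) ->
  (forall i j : 'I_n, i < T -> j < T -> c i j -> ~~ F (f0 i) (f0 j)) ->
  (forall i j : 'I_n, n <= 8 * D * deg F (f0 i) -> (i == j) || c i j -> j < T) ->
  2 * (T + 1 + D) < n ->
  exists f : {perm 'I_n}, forall i j, c i j -> ~~ F (f i) (f j).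
Proof.
move=> csym cirr Fsym degc okT high nT.
pose P (f : {perm 'I_n}) := [forall i : 'I_n, (i < T) ==> (f i == f0 i)].
pose conf (f : {perm 'I_n}) := [set p : 'I_n * 'I_n | c p.1 p.2 && F (f p.1) (f p.2)].
have Pf0 : P f0 by apply/forallP=> i; rewrite eqxx implybT.
case: (@arg_minnP _ f0 P (fun f => #|conf f|) Pf0) => f Pf fmin.
exists f => i0 j0 cij0; apply/negP => Fij0.
have fE (i : 'I_n) : i < T -> f i = f0 i by move=> iT; apply/eqP; exact: (implyP (forallP Pf i)).
(* A vertex of large degree sits below [T] under [f0], hence at the same position under [f], so
   [high] carries over to [f]. *)
have highf (i j : 'I_n) : n <= 8 * D * deg F (f i) -> (i == j) || c i j -> j < T.
  move=> hi cij; pose i' := (f0^-1)%g (f i).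
  have fi' : f0 i' = f i by rewrite permKV.
  have i'T : i' < T by apply: (high i' i'); rewrite ?fi' ?eqxx.
  have ii' : i' = i by apply: (@perm_inj _ f); rewrite fE.
  by apply: (high i j) => //; rewrite -{1}ii' fi'.
have [i [j [cij Fij jT]]] : exists i j, [/\ c i j, F (f i) (f j) & T <= j].
  case: (leqP T j0) => jT; first by exists i0, j0.
  case: (leqP T i0) => iT; first by exists j0, i0; rewrite csym Fsym.
  by have := okT _ _ iT jT cij0; rewrite -!fE // Fij0.
have D0 : 0 < D by rewrite (leq_trans _ (degc j)) // card_gt0; apply/set0Pn; exists i; rewrite inE csym.
have lowj (a : 'I_n) : (j == a) || c j a -> 8 * D * deg F (f a) < n.
  move=> ja; rewrite ltnNge; apply/negP => h.
  by have := highf a j h; rewrite eq_sym csym ja ltnNge jT => /(_ isT).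
have cardF v : #|[set q | F v (f q)]| = deg F v.
  rewrite /deg -(card_preimset [set w | F v w] (@perm_inj _ f)).
  by apply: eq_card => q; rewrite !inE.
(* A swap partner of [j] must avoid: frozen positions, neighbours of [j], positions whose vertex
   conflicts with one next to [j], and positions next to a vertex in conflict with [f j]. *)
pose A1 := [set q : 'I_n | q < T].
pose A2 := [set q | c j q].
pose A3 := \bigcup_(a in A2) [set q | F (f a) (f q)].
pose A4 := \bigcup_(a in [set a | F (f j) (f a)]) [set q | c a q].
have cA1 : #|A1| <= T.
  rewrite cardE -(size_map val) -(size_iota 0 T).
  apply: uniq_leq_size; first by rewrite map_inj_uniq ?enum_uniq //; exact: val_inj.
  by move=> _ /mapP[q qin ->]; move: qin; rewrite mem_enum inE mem_iota.
have cA2 : #|A2| <= D by exact: degc.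
have cA3 : 4 * #|A3| <= n.
  have H : #|A3| <= #|A2| * (n %/ (8 * D)).
    apply: card_bigcup_leq => a; rewrite inE => ja; rewrite cardF.
    by rewrite leq_divRL ?muln_gt0 // mulnC ltnW // lowj // ja orbT.
  have := leq_mul cA2 (leqnn (n %/ (8 * D))); have := leq_divM n (8 * D).
  by move: H; set x := n %/ _; set y := #|A2| * x; nia.
have cA4 : 4 * #|A4| <= n.
  have H : #|A4| <= deg F (f j) * D by rewrite -cardF; apply: card_bigcup_leq => a _; exact: degc.
  by have := lowj j; rewrite eqxx => /(_ isT); nia.
(* Moving the vertex [f j] to a position [q] outside these sets, and [f q] to
   [j], removes the conflict [(i, j)] and creates none. *)
have /subsetPn[q _] : ~~ ([set: 'I_n] \subset A1 :|: [set j] :|: A2 :|: A3 :|: A4).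
  apply/negP => /subset_leq_card; rewrite cardsT card_ord => H.
  have [h1 _] := leq_card_setU (A1 :|: [set j] :|: A2 :|: A3) A4.
  have [h2 _] := leq_card_setU (A1 :|: [set j] :|: A2) A3.
  have [h3 _] := leq_card_setU (A1 :|: [set j]) A2.
  have [h4 _] := leq_card_setU A1 [set j]; move: h4; rewrite cards1 => h4.
  clear - cA1 cA2 cA3 cA4 nT H h1 h2 h3 h4.
  move: cA1 cA2 cA3 cA4 nT H h1 h2 h3 h4.
  move: #|A1| #|A2| #|A3| #|A4| #|_ :|: A4| #|_ :|: A3| #|_ :|: A2| #|_ :|: [set j]| => *.
  lia.
rewrite !inE -!orbA !negb_or => /and5P[qT qj cjq qA3 qA4].
have noz a : c j a -> ~~ F (f a) (f q).
  move=> ja; apply: contra qA3 => Faq; apply/bigcupP; exists a; by rewrite inE.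
have now a : c q a -> ~~ F (f j) (f a).
  move=> qa; apply: contra qA4 => Fja; apply/bigcupP; exists a; by rewrite inE // csym.
pose f' := (tperm j q * f)%g.
have f'j : f' j = f q by rewrite permM tpermL.
have f'q : f' q = f j by rewrite permM tpermR.
have f'D a : a != j -> a != q -> f' a = f a.
  by move=> aj aq; rewrite permM tpermD // eq_sym.
have Pf' : P f'.
  apply/forallP => a; apply/implyP => aT; rewrite f'D ?fE //.
    by apply: contraTneq aT => ->; rewrite -leqNgt.
  by apply: contraTneq aT => ->.
have := fmin _ Pf'; rewrite leqNgt => /negP; apply; apply: proper_card.
(* As [q] is not adjacent to [j], the neighbours of both keep their vertices under the swap, so no
   conflict of [f'] meets [j] or [q]. *)
have nobad a b : (a == j) || (a == q) -> c a b -> ~~ F (f' a) (f' b).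
  case/orP=> /eqP ->.
    move=> cjb; rewrite f'j f'D; first by rewrite Fsym noz.
      by apply: contraTneq cjb => ->; rewrite cirr.
    by apply: contraTneq cjb => ->.
  move=> cqb; rewrite f'q f'D; first exact: now.
    by apply: contraTneq cqb => ->; rewrite csym.
  by apply: contraTneq cqb => ->; rewrite cirr.
apply/properP; split; last first.
  exists (i, j); rewrite inE /= ?cij ?Fij //=.
  by rewrite Fsym; apply: nobad; rewrite ?eqxx // csym.
apply/subsetP => -[a b]; rewrite !inE /= => /andP[cab Fab]; rewrite cab /=.
have na : ~~ ((a == j) || (a == q)) by apply: contraL Fab => ha; exact: nobad.
have nb : ~~ ((b == j) || (b == q)).
  by apply: contraL Fab => hb; rewrite Fsym nobad // csym.
by move: na nb Fab; rewrite !negb_or => /andP[? ?] /andP[? ?]; rewrite !f'D.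
Qed.

(** * Windows around the vertices of large degree *)

Lemma perm_of_uniq n (x0 : 'I_n) (s : seq 'I_n) :
  uniq s -> exists f : {perm 'I_n}, forall i : 'I_n, i < size s -> f i = nth x0 s i.
Proof.
move=> us; pose s' := s ++ [seq x <- enum 'I_n | x \notin s].
have us' : uniq s'.
  rewrite cat_uniq us filter_uniq ?enum_uniq // andbT /=.
  by apply/hasPn => x; rewrite mem_filter => /andP[].
have sz : size s' = n.
  rewrite -[RHS]size_enum_ord; apply: perm_size; apply: uniq_perm; rewrite ?enum_uniq //.
  by move=> x; rewrite mem_cat mem_filter mem_enum andbT orbN.
have inj : injective (fun i : 'I_n => nth x0 s' i).
  move=> i j /eqP; rewrite nth_uniq ?sz // => /eqP ij; exact: val_inj.
by exists (perm inj) => i ilt; rewrite permE nth_cat ilt.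
Qed.

(** The vertices are chosen one after another; each earlier choice excludes only itself and its at
    most [K] F-neighbours. *)
Lemma greedy_independent n (x0 : 'I_n) (F : rel 'I_n) (A : nat -> {set 'I_n}) K m :
  (forall p v, p < m -> v \in A p -> deg F v <= K) ->
  (forall p, p < m -> m * (K + 1) < #|A p|) ->
  exists ys : nat -> 'I_n, forall p, p < m ->
    ys p \in A p /\ forall q, q < p -> ys q != ys p /\ ~~ F (ys q) (ys p).
Proof.
elim: m => [|m IH] lowA bigA; first by exists (fun=> x0).
have [||ys ysP] := IH.
- by move=> p v pm; apply: lowA; rewrite ltnW.
- by move=> p pm; apply: leq_trans (bigA p _); rewrite ?ltnS ?leq_mul2r ?leqnSn ?orbT // ltnW.
pose X := \bigcup_(q in [set: 'I_m]) (ys q |: [set w | F (ys q) w]).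
have cX : #|X| <= m * (K + 1).
  rewrite -[m in m * _]card_ord -cardsT; apply: card_bigcup_leq => q _.
  rewrite cardsU1 addnC leq_add //; last by case: (_ \notin _).
  by have [yA _] := ysP q (ltn_ord q); apply: (lowA q); rewrite // ltnW // ltnS.
have /subsetPn[y yA yX] : ~~ (A m \subset X).
  apply/negP => /subset_leq_card h; have := bigA m (leqnn _).
  by have := leq_trans h cX; clear; lia.
exists (fun p => if p == m then y else ys p) => p; rewrite ltnS leq_eqVlt.
case: eqP => [-> _|_ /= pm]; last first.
  have [h1 h2] := ysP _ pm; split=> // q qp.
  by rewrite (ltn_eqF (ltn_trans qp pm)); exact: h2.
split=> // q qm; rewrite (ltn_eqF qm).
have /norP : ~~ ((y == ys q) || F (ys q) y).
  apply: contra yX => h; apply/bigcupP; exists (Ordinal qm); rewrite ?inE //.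
by rewrite eq_sym => -[? ?].
Qed.

(** [i] is the centre of window number [b]. The window does not wrap around the cycle, so it
    contains all neighbours of its centre. *)
Lemma cycle_pow_block n k b (i j : 'I_n) :
  i = b * (2 * k + 1) + k :> nat -> i + k < n -> (i == j) || cycle_pow k i j ->
  j %/ (2 * k + 1) = b /\ (i != j -> j %% (2 * k + 1) != k).
Proof.
move=> ib ikn cij.
have [r jr rk] : exists2 r, j = b * (2 * k + 1) + r :> nat & r < 2 * k + 1.
  exists (j - b * (2 * k + 1)).
    by case/orP: cij => [/eqP <-|]; rewrite /cycle_pow /cycdist ?ib; have := ltn_ord j; lia.
  by case/orP: cij => [/eqP <-|]; rewrite /cycle_pow /cycdist ?ib; have := ltn_ord j; lia.
have w0 : 0 < 2 * k + 1 by rewrite addn1.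
rewrite jr divnMDl // (divn_small rk) addn0.
split=> // ij; rewrite modnMDl (modn_small rk).
apply: contra ij => /eqP rE; apply/eqP; apply: val_inj => /=; lia.
Qed.

(** The vertices of [B] become centres of consecutive windows and [ys] fills the rest of these
    windows. The prefix so obtained meets the requirements of [packing_extend] with degree bound
    [2 * k], whence the factor [16 * k]. *)
Lemma packing_blocks n k (x0 : 'I_n) (F : rel 'I_n) (B : seq 'I_n) (ys : nat -> 'I_n) :
  0 < k -> symmetric F -> uniq B ->
  2 * (size B * (2 * k + 1) + 1 + 2 * k) < n ->
  (forall v, n <= 16 * k * deg F v -> v \in B) ->
  (forall p, p < size B * (2 * k + 1) -> p %% (2 * k + 1) != k ->
     [/\ ys p \notin B, ~~ F (nth x0 B (p %/ (2 * k + 1))) (ys p) &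
      forall q, q < p -> q %% (2 * k + 1) != k -> ys q != ys p /\ ~~ F (ys q) (ys p)]) ->
  exists f : {perm 'I_n}, forall i j, cycle_pow k i j -> ~~ F (f i) (f j).
Proof.
set w := 2 * k + 1; set T := size B * w => k0 Fsym uB nT highB ysP.
have w0 : 0 < w by rewrite /w addn1.
have divT p : (p < T) = (p %/ w < size B) by rewrite ltn_divLR.
pose g p := if p %% w == k then nth x0 B (p %/ w) else ys p.
have gneq p q : p < T -> q < p -> g q != g p.
  move=> pT qp; have qT := ltn_trans qp pT; rewrite /g.
  case: (q %% w =P k) => [qk|/eqP qk]; case: (p %% w =P k) => [pk|/eqP pk].
  - rewrite nth_uniq -?divT //; apply: contraTneq qp => h.
    by rewrite (divn_eq p w) (divn_eq q w) pk qk h ltnn.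
  - have [pB _ _] := ysP p pT pk; apply: contraNneq pB => <-.
    by rewrite mem_nth // -divT.
  - have [qB _ _] := ysP q qT qk; apply: contraNneq qB => ->.
    by rewrite mem_nth // -divT.
  - by have [_ _ h] := ysP p pT pk; case: (h q qp qk).
have ginj p q : p < T -> q < T -> g p = g q -> p = q.
  move=> pT qT gpq; case: (ltngtP p q) => // h.
    by have := gneq _ _ qT h; rewrite gpq eqxx.
  by have := gneq _ _ pT h; rewrite gpq eqxx.
have [f0 f0E] : exists f : {perm 'I_n}, forall i : 'I_n, i < T -> f i = g i.
  have [|f0 f0P] := @perm_of_uniq n x0 (mkseq g T).
    rewrite map_inj_in_uniq ?iota_uniq // => p q; rewrite !mem_iota /= !add0n.
    by move=> pT qT; exact: ginj.
  by exists f0 => i iT; rewrite f0P ?size_mkseq // nth_mkseq.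
have near (i j : 'I_n) : i < T -> i %% w = k -> (i == j) || cycle_pow k i j ->
    j %/ w = i %/ w /\ (i != j -> j %% w != k).
  move=> iT ik cij; apply: cycle_pow_block cij; first by rewrite {1}(divn_eq i w) ik.
  by clear - iT nT; lia.
apply: (@packing_extend n (@cycle_pow n k) F (2 * k) T f0) => //.
- exact: cycle_pow_sym.
- exact: cycle_pow_irr.
- exact: deg_cycle_pow.
- suff H (i j : 'I_n) : i < T -> j < T -> (j < i) -> cycle_pow k i j -> ~~ F (g i) (g j).
    move=> i j iT jT cij; rewrite !f0E //; case: (ltngtP i j) => ij.
    + by rewrite Fsym; apply: H => //; rewrite cycle_pow_sym.
    + exact: H.
    + by move: cij; rewrite (val_inj ij) cycle_pow_irr.
  move=> iT jT ji cij; rewrite /g.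
  have nij : i != j by apply: contraTneq ji => ->; rewrite ltnn.
  (* Two centres are never adjacent, a centre is adjacent only to fillers of its own window, and two
     fillers are not F-adjacent by choice. *)
  case: (i %% w =P k) => [ik|/eqP ik]; case: (j %% w =P k) => [jk|/eqP jk].
  + have [|_ /(_ nij)] := near i j iT ik; first by rewrite cij orbT.
    by rewrite jk eqxx.
  + have [|<- _] := near i j iT ik; first by rewrite cij orbT.
    by have [] := ysP j jT jk.
  + have [|<- _] := near j i jT jk; first by rewrite cycle_pow_sym cij orbT.
    by rewrite Fsym; have [] := ysP i iT ik.
  + by have [_ _ h] := ysP i iT ik; rewrite Fsym; have [] := h j ji jk.
- move=> i j hi cij.
  have vB : f0 i \in B by apply: highB; move: hi; rewrite (_ : 8 * (2 * k) = 16 * k) //; lia.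
  pose p := index (f0 i) B * w + k.
  have pdiv : p %/ w = index (f0 i) B.
    by rewrite divnMDl // divn_small ?addn0 // /w; lia.
  have pmod : p %% w = k by rewrite modnMDl modn_small // /w; lia.
  have pT : p < T by rewrite divT pdiv index_mem.
  have pn : p < n by clear - pT nT; lia.
  have ip : Ordinal pn = i.
    by apply: (@perm_inj _ f0); rewrite f0E //= /g pmod eqxx pdiv nth_index.
  have iT : i < T by rewrite -ip.
  have [|h _] := near i j iT _ cij; first by rewrite -ip.
  by rewrite divT h -divT.
Qed.

(** * Sparse complements without a dominating vertex *)

Lemma card_setU_leq (T : finType) (A B : {set T}) a b :
  #|A| <= a -> #|B| <= b -> #|A :|: B| <= a + b.
Proof. by move=> Aa Bb; apply: leq_trans (leq_add Aa Bb); exact: leq_card_setU. Qed.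

Lemma sum_mem_card (T : finType) (A : {set T}) c : \sum_v (v \in A) * c = #|A| * c.
Proof.
rewrite -big_distrl /= -sum1_card [in RHS]big_mkcond /=.
by congr (_ * _); apply: eq_bigr => v _; case: (_ \in _).
Qed.

Lemma card_ge_mul_leq_sum (T : finType) (f : T -> nat) (A : {set T}) c :
  (forall v, v \in A -> c <= f v) -> #|A| * c <= \sum_v f v.
Proof.
move=> Af; rewrite -sum_mem_card; apply: leq_sum => v _.
by case: (boolP (v \in A)) => [/Af|]; rewrite ?mul1n ?mul0n.
Qed.

(** Since every factor [n - 1 - deg F v] is at least [(n - 1) / D], the F-degrees sum to at most
    [D * (n - 1)]. So at most [D ^ 2] vertices ([Hs]) need a window, and few ([L]) have degree above
    [K]; fillers are taken greedily outside both sets. *)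
Lemma packing_spread n k (F : rel 'I_n) :
  0 < k -> symmetric F ->
  let D := 16 * k in
  2 * D * (D ^ 2 + D ^ 2 * (2 * k + 1) * (2 * D ^ 2 + 1)) + 1 < n ->
  2 * (D ^ 2 * (2 * k + 1) + 1 + 2 * k) < n ->
  (forall v, n - 1 <= D * (n - 1 - deg F v)) ->
  \sum_v deg F v * (n - 1 - deg F v) <= (n - 1) ^ 2 ->
  exists f : {perm 'I_n}, forall i j, cycle_pow k i j -> ~~ F (f i) (f j).
Proof.
move=> k0 Fsym D; set K := 2 * D ^ 2; set w := 2 * k + 1.
move=> nbig nbig2 gbig sumle.
have D0 : 0 < D by rewrite muln_gt0.
have n1 : 1 < n by clear - nbig; lia.
have n0 : 0 < n by clear - n1; lia.
have sumd : \sum_v deg F v <= D * (n - 1).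
  rewrite -(@leq_pmul2r (n - 1)); last by rewrite subn_gt0.
  rewrite -mulnA mulnn (leq_trans _ (leq_mul (leqnn D) sumle)) //.
  rewrite big_distrl big_distrr /=; apply: leq_sum => v _.
  by rewrite mulnCA leq_mul2l gbig orbT.
pose Hs := [set v | n <= D * deg F v].
pose L := [set v | K < deg F v].
have cHs : #|Hs| <= D ^ 2.
  rewrite -(@leq_pmul2r n) //.
  apply: (@leq_trans (\sum_v D * deg F v)).
    by apply: card_ge_mul_leq_sum => v; rewrite inE.
  rewrite -big_distrr /= -mulnn -mulnA leq_mul2l; apply/orP; right.
  by rewrite (leq_trans sumd) // leq_mul2l leq_subr orbT.
have cL : 2 * D * #|L| <= n - 1.
  rewrite -(@leq_pmul2l D) //; apply: leq_trans sumd.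
  rewrite (_ : _ * _ = #|L| * K); last by rewrite /K -mulnn; clear; lia.
  by apply: card_ge_mul_leq_sum => v; rewrite inE => /ltnW.
pose B := enum Hs; pose x0 := Ordinal n0.
have sB : size B = #|Hs| by rewrite -cardE.
pose A p := [set v | [&& v != nth x0 B (p %/ w), ~~ F (nth x0 B (p %/ w)) v, v \notin L & v \notin Hs]].
have cA b : n - 1 - deg F b <=
    #|[set v | [&& v != b, ~~ F b v, v \notin L & v \notin Hs]]| + #|L| + #|Hs|.
  set Y := [set v | _].
  have : [set: 'I_n] \subset [set b] :|: [set v | F b v] :|: Y :|: L :|: Hs.
    apply/subsetP => v _; rewrite !inE.
    by case: (v == b) => //=; case: (F b v) => //=; case: (K < _) => //=; case: (n <= _).
  move/subset_leq_card; rewrite cardsT card_ord => H.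
  have : n <= 1 + deg F b + #|Y| + #|L| + #|Hs|.
    by apply: leq_trans H _; do 4! apply: card_setU_leq => //; rewrite cards1.
  by clear; lia.
have [|p _|ys ysP] := @greedy_independent n x0 F A K (size B * w).
- by move=> p v _; rewrite !inE -!leqNgt => /and4P[].
(* A centre has at least [(n - 1) / D] non-neighbours; [L] removes at most half of that number and
   [Hs] at most [D ^ 2]. The first bound on [n] makes the remainder large enough. *)
- have := cA (nth x0 B (p %/ w)); rewrite -/(A p).
  have := gbig (nth x0 B (p %/ w)).
  move: cL cHs nbig; rewrite sB -/K -/w.
  move: #|A p| #|L| #|Hs| (deg _ _) => a l h d cL cHs nbig g1 g2.
  rewrite ltnNge; apply/negP => ale.
  have e1 : a <= D ^ 2 * w * (K + 1).
    by rewrite (leq_trans ale) // leq_mul2r leq_mul2r cHs !orbT.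
  have e2 : n - 1 - d <= l + (D ^ 2 + D ^ 2 * w * (K + 1)).
    by clear - e1 cHs g2; lia.
  have := leq_mul (leqnn (2 * D)) e2; rewrite mulnDr.
  by clear - g1 cL nbig n1; move: (2 * D * (_ + _)) nbig => Z; lia.
apply: (@packing_blocks n k x0 F B ys) => //.
- exact: enum_uniq.
- apply: leq_ltn_trans nbig2; rewrite leq_mul2l /= leq_add2r leq_add2r leq_mul2r.
  by rewrite sB cHs orbT.
- by move=> v hv; rewrite mem_enum inE.
move=> p pT pk; have [] := ysP p pT; rewrite inE => /and4P[h1 h2 h3 h4] h5.
by split=> //; [rewrite mem_enum | move=> q qp _; exact: h5].
Qed.

(** * Complements with a dominating vertex *)

(** Here [N] is [n - 1], [d] the F-degree of the dominating vertex and [x] the number of ends of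
    F-edges avoiding it. With [g = N - d] the main hypothesis becomes
    [x * (N - 3) + g <= N + g ^ 2], so [x] is roughly at most [1 + g ^ 2 / N], which is small
    because [16 * k * g < N]. *)
Lemma dominated_arith k N d x :
  0 < k -> 1000 * k + (4 * k + 6) ^ 2 + 8 <= N + 1 -> d + 2 * k <= N ->
  16 * k * (N - d) < N ->
  d * (N - 1) + x * (N - 3) + d * (N - d) <= N ^ 2 -> (x == 0) || (1 < x) ->
  2 * k + x <= N - d /\ 16 * k * (1 + x) < N + 1.
Proof.
move=> k0 nbig dk gu key x2.
have [g Ng] : exists g, N = d + g by exists (N - d); lia.
have gE : N - d = g by lia.
rewrite gE in key gu *.
have key' : x * (N - 3) + g <= N + g ^ 2.
  have h1 : d * (N - 1) = d * N - d by rewrite mulnBr muln1.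
  have h2 : d <= d * N by rewrite leq_pmulr //; lia.
  have h3 : N ^ 2 = d * N + (d * g + g ^ 2) by rewrite Ng; clear; ring.
  by clear - key h1 h2 h3 Ng; lia.
have gN : 16 * g <= N.
  by apply: leq_trans (ltnW gu); rewrite leq_mul2r -{1}(muln1 16) leq_mul2l k0 !orbT.
have N0 : 6 + (4 * k + 6) ^ 2 < N by clear - nbig k0; lia.
have kg : 2 * k <= g by clear - dk Ng; lia.
have NL : 1000 * k <= N by clear - nbig; lia.
clear key gE d Ng dk nbig.
split.
  (* For small [g] the bound forces [x < 2], hence [x = 0]. *)
  case: (ltnP g (4 * k + 6)) => gk.
    have gg : g ^ 2 <= (4 * k + 6) ^ 2 by rewrite leq_exp2r // ltnW.
    case/orP: x2 => [/eqP ->|x2]; first by rewrite addn0.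
    have : 2 * (N - 3) <= x * (N - 3) by rewrite leq_mul2r x2 orbT.
    by clear - key' N0 gg; lia.
  (* For larger [g], failure means [2 * x >= g + 8], so [x * (N - 3)] is at least [(g + 8) * N / 4],
     more than [N + g * N / 16] allows. *)
  rewrite leqNgt; apply/negP => hx.
  have h1 : g + 8 <= 2 * x by clear - hx gk; lia.
  have h2 : (g + 8) * N <= 2 * x * (2 * (N - 3)) by apply: leq_mul => //; clear - N0; lia.
  have h3 : 16 * (g * g) <= g * N by rewrite mulnCA leq_mul2l gN orbT.
  have h4 : 2 * x * (2 * (N - 3)) = 4 * (x * (N - 3)) by clear; ring.
  move: h2 key'; rewrite h4 -mulnn mulnDl; clear - h3 N0.
  by move: (x * _) (g * N) (g * g) h3 => a b c; lia.
(* Failure here would give [N - 3 <= 32 * k + g] with [g <= N / 16], against [N >= 1000 * k]. *)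
rewrite ltnNge; apply/negP => hx.
have h1 : 16 * k * g * g <= N * g by rewrite leq_mul2r ltnW ?orbT.
have h2 : 16 * k * (x * (N - 3)) <= 16 * k * (N + g ^ 2).
  by rewrite leq_mul2l; apply/orP; right; clear - key'; lia.
have h3 : N * (N - 3) <= 16 * k * (1 + x) * (N - 3).
  by rewrite leq_mul2r; apply/orP; right; clear - hx; lia.
have h4 : N * (N - 3) <= N * (32 * k + g).
  apply: leq_trans h3 _; have h5 : 16 * k * (N - 3) <= 16 * k * N by rewrite leq_mul2l leq_subr orbT.
  have -> : 16 * k * (1 + x) * (N - 3) = 16 * k * (N - 3) + 16 * k * (x * (N - 3)) by clear; ring.
  apply: leq_trans (leq_add h5 h2) _.
  have -> : 16 * k * N + 16 * k * (N + g ^ 2) = 32 * k * N + 16 * k * g * g by clear; ring.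
  have -> : N * (32 * k + g) = 32 * k * N + N * g by clear; ring.
  by rewrite leq_add2l.
by move: h4; rewrite leq_pmul2l; clear - gN NL k0 N0; lia.
Qed.

(** [E] collects the ends of F-edges avoiding [u]. Once [E] is shown to be small, [u] is the only
    vertex that needs a window, and the isolated vertices of F suffice to fill it. *)
Lemma packing_dominated n k (F : rel 'I_n) (u : 'I_n) :
  0 < k -> symmetric F -> irreflexive F ->
  1000 * k + (4 * k + 6) ^ 2 + 8 <= n ->
  (forall v, deg F v + 2 * k <= n - 1) ->
  16 * k * (n - 1 - deg F u) < n - 1 ->
  \sum_v deg F v * (n - 1 - deg F v) <= (n - 1) ^ 2 ->
  exists f : {perm 'I_n}, forall i j, cycle_pow k i j -> ~~ F (f i) (f j).
Proof.
move=> k0 Fsym Firr nbig gmin gu sumle.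
pose E := [set v | (v != u) && [exists w, (w != u) && F v w]].
have inE' v w : v != u -> w != u -> F v w -> v \in E.
  by move=> vu wu Fvw; rewrite inE vu /=; apply/existsP; exists w; rewrite wu.
have degE v : v != u -> F u v + (v \in E) <= deg F v.
  move=> vu; have d1 w : F v w -> 0 < deg F v.
    by move=> Fvw; rewrite card_gt0; apply/set0Pn; exists w; rewrite inE.
  case: (boolP (v \in E)); last first.
    by rewrite addn0 => _; case: (boolP (F u v)); rewrite // Fsym => /d1.
  rewrite inE vu /= => /existsP[w /andP[wu Fvw]]; case: (boolP (F u v)) => [Fuv|_].
    rewrite (_ : _ + _ = #|[set u; w]|); last by rewrite cards2 eq_sym wu.
    by apply/subset_leq_card/subsetP => z /set2P[] ->; rewrite inE // Fsym.
  exact: d1 Fvw.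
(* Since d(v) <= n - 3, the product d(v) (n - 1 - d(v)) is at least n - 2 if
   d(v) >= 1, and at least (n - 2) + (n - 4) if d(v) >= 2. *)
have key : deg F u * (n - 2) + #|E| * (n - 4) + deg F u * (n - 1 - deg F u) <= (n - 1) ^ 2.
  apply: leq_trans sumle; have -> : deg F u * (n - 1 - deg F u) =
      \sum_v (v == u) * (deg F v * (n - 1 - deg F v)).
    by rewrite (bigD1 u) //= eqxx mul1n big1 ?addn0 // => v /negbTE ->.
  rewrite -(sum_mem_card E) {1}/deg -(sum_mem_card [set w | F u w]) -!big_split /=.
  apply: leq_sum => v _; rewrite !inE.
  case: (altP (v =P u)) => [-> /=|vu]; first by rewrite Firr /= !mul0n mul1n.
  have := degE v vu; have := gmin v; rewrite !inE vu /=.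
  move: (deg F v) (F u v) [exists w, _] => d [] [] /=; nia.
(* An F-edge avoiding [u] puts both its ends in [E]. *)
have E2 : E != set0 -> 1 < #|E|.
  case/set0Pn => v; rewrite inE => /andP[vu /existsP[w /andP[wu Fvw]]].
  rewrite (_ : 1 < _ = (#|[set v; w]| <= #|E|)); last first.
    by rewrite cards2; case: (altP (v =P w)) Fvw => // ->; rewrite Firr.
  apply/subset_leq_card/subsetP => z /set2P[] ->; first exact: (inE' v w).
  by apply: (inE' w v); rewrite // Fsym.
have degle v : v != u -> deg F v <= 1 + #|E|.
  move=> vu; have := leq_card_setU [set u] E; rewrite cards1 => -[h _].
  apply: leq_trans h; apply/subset_leq_card/subsetP => w; rewrite inE => Fvw.
  rewrite in_setU in_set1; case: (altP (w =P u)) => //= wu.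
  by apply: (inE' w v); rewrite // Fsym.
pose I := [set v | deg F v == 0].
(* Every vertex is [u], an F-neighbour of [u], isolated in F, or in [E]. *)
have cI : n - 1 - deg F u <= #|I| + #|E|.
  have : [set: 'I_n] \subset [set u] :|: [set v | F u v] :|: I :|: E.
    apply/subsetP => v _; rewrite in_setU orbC -implyNb; apply/implyP => vE.
    rewrite !in_setU in_set1; case: (altP (v =P u)) => //= vu; rewrite [v \in I]inE inE.
    case: (boolP (F u v)) => //= Fuv; rewrite cards_eq0; apply/eqP/setP => w.
    rewrite !in_set; apply: contraNF vE => Fvw; apply: (inE' v w) => //.
    by apply: contraNneq Fuv => <-; rewrite Fsym.
  move/subset_leq_card; rewrite cardsT card_ord => H.
  have : n <= 1 + deg F u + #|I| + #|E|.
    by apply: leq_trans H _; do 3! apply: card_setU_leq => //; rewrite cards1.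
  by clear; lia.
have [Ismall Elow] : 2 * k + #|E| <= n - 1 - deg F u /\ 16 * k * (1 + #|E|) < n.
  have : (#|E| == 0) || (1 < #|E|) by rewrite cards_eq0 -implyNb; apply/implyP.
  have := gmin u; move: key gu; clear - nbig k0.
  have [N nN] : exists N, n = N + 1 by exists (n - 1); lia.
  have [-> -> ->] : [/\ n - 1 = N, n - 2 = N - 1 & n - 4 = N - 3] by split; lia.
  move: #|E| (deg F u) nbig => x d; rewrite {}nN => nbig key gu dk x2.
  have gu' : 16 * k * (N - d) < N by [].
  exact: dominated_arith.
have I2k : 2 * k <= #|I| by rewrite -(leq_add2r #|E|) (leq_trans Ismall).
have [v0 v0I] : exists v, v \in I.
  by apply/set0Pn; rewrite -card_gt0; apply: leq_trans I2k; rewrite muln_gt0.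
pose w := 2 * k + 1.
(* The centre [k] is reserved for [u]; skipping it numbers the other positions of the window from 0
   to [2 * k - 1]. *)
pose ys p := nth v0 (enum I) (if p < k then p else p.-1).
apply: (@packing_blocks n k v0 F [:: u] ys) => //=.
- by rewrite mul1n; clear - nbig; lia.
- move=> v hv; rewrite inE; apply: contraLR hv => vu; rewrite -ltnNge.
  by apply: leq_ltn_trans Elow; rewrite leq_mul2l degle ?orbT.
rewrite mul1n => p pw; rewrite modn_small // divn_small //= => pk.
have idx q : q < w -> q != k -> (if q < k then q else q.-1) < #|I|.
  rewrite /w => h1 /eqP h2; apply: leq_trans I2k; clear - h1 h2.
  by case: (ltnP q k); lia.
have ysI q : q < w -> q != k -> ys q \in I.
  by move=> qw qk; rewrite -mem_enum mem_nth // -cardE idx.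
have isoF v z : v \in I -> ~~ F z v.
  rewrite inE cards_eq0 => /eqP /setP /(_ z); rewrite !inE Fsym => ->//.
have du : 0 < deg F u.
  rewrite lt0n; apply: contraTneq gu => ->.
  by rewrite subn0 -leqNgt leq_pmull ?muln_gt0.
split; first by rewrite inE; apply: contraTneq (ysI p pw pk) => ->; rewrite inE -lt0n.
  exact/isoF/ysI.
move=> q qp; have qw := ltn_trans qp pw.
rewrite modn_small // => qk; split; last exact/isoF/ysI.
rewrite nth_uniq -?cardE ?idx ?enum_uniq //.
move/eqP: pk => pk; move/eqP: qk => qk; clear - qp pk qk.
by apply/eqP; case: (ltnP q k); case: (ltnP p k); lia.
Qed.

(** * Largest eigenvalues and Rayleigh quotients *)

Local Open Scope ring_scope.

Definition quad (R : realType) n (A : 'M[R]_n) (x : 'rV[R]_n) : R :=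
  \sum_i \sum_j A i j * (x 0 i * x 0 j).

Definition sqnorm (R : realType) n (x : 'rV[R]_n) : R := \sum_i x 0 i ^+ 2.

Definition bil (R : realType) n (A : 'M[R]_n) (x y : 'rV[R]_n) : R :=
  \sum_i \sum_j A i j * (x 0 i * y 0 j).

Lemma sqnorm_ge0 (R : realType) n (x : 'rV[R]_n) : 0 <= sqnorm x.
Proof. by apply: sumr_ge0 => i _; exact: sqr_ge0. Qed.

Lemma sqnorm_eq0 (R : realType) n (x : 'rV[R]_n) : sqnorm x = 0 -> x = 0.
Proof.
move/eqP; rewrite psumr_eq0 => [/allP h|i _]; last exact: sqr_ge0.
apply/rowP => i; rewrite mxE; apply/eqP; rewrite -sqrf_eq0.
by apply: (h i); rewrite mem_index_enum.
Qed.

Lemma quad_eigen (R : realType) n (A : 'M[R]_n) (x : 'rV[R]_n) l :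
  x *m A = l *: x -> quad A x = l * sqnorm x.
Proof.
move=> xA; rewrite /quad exchange_big /sqnorm mulr_sumr; apply: eq_bigr => j _.
rewrite expr2 mulrA; have := congr1 (fun M : 'rV_n => M 0 j) xA.
rewrite !mxE => <-; rewrite mulr_suml; apply: eq_bigr => i _.
by rewrite mulrA [A _ _ * _]mulrC.
Qed.

(** First-order condition: [Q] is nonnegative and vanishes at [x], while its linear term in the
    direction [y = l x - x A] is [2 t |y|^2]. This is impossible for small negative [t] unless
    [y = 0]. *)
Lemma maximizer_eigen (R : realType) n (A : 'M[R]_n) (x : 'rV[R]_n) l :
  (forall i j, A i j = A j i) ->
  (forall y, quad A y <= l * sqnorm y) -> l * sqnorm x <= quad A x ->
  x *m A = l *: x.
Proof.
move=> Asym max lx; pose y := l *: x - x *m A.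
have yE j : y 0 j = l * x 0 j - \sum_i x 0 i * A i j by rewrite !mxE.
suff y0 : sqnorm y = 0.
  by apply/esym/eqP; rewrite -subr_eq0; apply/eqP; exact: sqnorm_eq0.
pose Q z := l * sqnorm z - quad A z.
have expand t : Q (x + t *: y) = Q x + 2 * t * sqnorm y + t ^+ 2 * Q y.
  have sq : sqnorm (x + t *: y) = sqnorm x + 2 * t * (\sum_i x 0 i * y 0 i) + t ^+ 2 * sqnorm y.
    rewrite /sqnorm !mulr_sumr -!big_split /=; apply: eq_bigr => i _; rewrite !mxE; ring.
  have qd : quad A (x + t *: y) = quad A x + 2 * t * bil A x y + t ^+ 2 * quad A y.
    have bilC : bil A x y = bil A y x.
      rewrite /bil exchange_big; apply: eq_bigr => i _; apply: eq_bigr => j _.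
      by rewrite Asym [y 0 i * _]mulrC.
    have -> : 2 * t * bil A x y = t * bil A x y + t * bil A y x by rewrite -bilC; ring.
    rewrite /quad /bil !mulr_sumr -!big_split /=; apply: eq_bigr => i _.
    rewrite !mulr_sumr -!big_split /=; apply: eq_bigr => j _; rewrite !mxE; ring.
  have yy : sqnorm y = l * (\sum_i x 0 i * y 0 i) - bil A x y.
    rewrite /sqnorm /bil exchange_big mulr_sumr -sumrB; apply: eq_bigr => j _.
    rewrite expr2 {1}yE mulrBl mulrA mulr_suml; congr (_ - _).
    by apply: eq_bigr => i _; ring.
  by rewrite /Q sq qd yy; ring.
have Qx : Q x <= 0 by rewrite subr_le0.
have Qpos z : 0 <= Q z by rewrite subr_ge0.
have c0 := Qpos y; have q0 := sqnorm_ge0 y.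
set c := Q y in c0 expand; set q := sqnorm y in q0 expand *.
(* This [t] turns [2 t q + t^2 c] into [- q^2 (c + 2) / (c + 1)^2]; the summand 1 avoids dividing by
   zero when [c = 0]. *)
pose t := - (q / (c + 1)).
have := Qpos (x + t *: y); rewrite expand => h.
have h2 : 0 <= 2 * t * q + t ^+ 2 * c by lra.
have c1 : 0 < c + 1 by lra.
have h3 : 0 <= q ^+ 2 * (- (c + 2)).
  have -> : q ^+ 2 * (- (c + 2)) = (2 * t * q + t ^+ 2 * c) * (c + 1) ^+ 2.
    by rewrite /t; field; lra.
  by rewrite mulr_ge0 // sqr_ge0.
by apply/eqP; rewrite -sqrf_eq0 -[_ == 0]orbF; apply/negP => /negP; rewrite orbF => q2; have := sqr_ge0 q; rewrite le0r (negbTE q2) /= => q3; nra.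
Qed.

Import numFieldNormedType.Exports.
Local Open Scope classical_set_scope.

Lemma continuous_addr (R : realType) : continuous (fun z : R * R => z.1 + z.2).
Proof. by move=> z; apply: cvgD; [exact: cvg_fst | exact: cvg_snd]. Qed.

Lemma quad_continuous (R : realType) n (A : 'M[R]_n) :
  continuous (quad A : 'rV[R]_n -> R).
Proof.
rewrite /quad; apply: (continuous_big (@continuous_addr R)) => i _.
apply: (continuous_big (@continuous_addr R)) => j _.
move=> x; pose f i (y : 'rV[R]_n) := y 0 i.
suff : {for x, continuous ((fun=> A i j) \* (f i \* f j))} by [].
apply: continuousM; first exact: cst_continuous.
by apply: continuousM; exact: coord_continuous.
Qed.

Lemma sqnorm_continuous (R : realType) n : continuous (@sqnorm R n).
Proof.
rewrite /sqnorm; apply: (continuous_big (@continuous_addr R)) => i _.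
move=> x; pose f (y : 'rV[R]_n) := y 0 i.
suff : {for x, continuous (f \* f)} by [].
by apply: continuousM; exact: coord_continuous.
Qed.

(** The unit sphere is closed and lies in the compact cube with sides [[-1, 1]], so the form attains
    a maximum on it; homogeneity extends the bound to all vectors. Positive dimension makes the
    sphere nonempty. *)
Lemma quad_max_ex (R : realType) n (A : 'M[R]_n.+1) :
  exists2 x, sqnorm x = 1 & forall y, quad A y <= quad A x * sqnorm y.
Proof.
pose S := [set x : 'rV[R]_n.+1 | sqnorm x = 1].
have S0 : S !=set0.
  exists (delta_mx 0 0); rewrite /S /= /sqnorm (bigD1 ord0) //= big1 => [|i i0].
    by rewrite mxE !eqxx expr1n addr0.
  by rewrite mxE (negbTE i0) expr0n.
have Scl : topology_structure.closed S.
  apply: (@preimage_closed _ _ (@sqnorm R n.+1) [set x | x = 1]); last exact: closed_eq.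
  by move=> x _; exact: sqnorm_continuous.
have Sc : compact S.
  apply: (@subclosed_compact _ _ [set v : 'rV[R]_n.+1 | forall i, `[(-1 : R), 1]%classic (v ord0 i)] Scl).
    apply: (@rV_compact _ _ (fun=> `[(-1 : R), 1]%classic)) => _.
    exact: segment_compact.
  move=> v /= v1 i; rewrite in_itv /= -ler_norml -(@ler_pXn2r _ 2) ?nnegrE ?normr_ge0 //.
  rewrite expr1n real_normK ?num_real // -v1 /sqnorm (bigD1 i) //= lerDl.
  by apply: sumr_ge0 => j _; exact: sqr_ge0.
have [x xS xmax] := EVT_max_rV S0 Sc (continuous_subspaceT (@quad_continuous R n.+1 A)).
exists x; first exact: set_mem xS.
have quadZ c y : quad A (c *: y) = c ^+ 2 * quad A y.
  rewrite /quad mulr_sumr; apply: eq_bigr => i _; rewrite mulr_sumr; apply: eq_bigr => j _.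
  by rewrite !mxE; ring.
have sqZ c (y : 'rV[R]_n.+1) : sqnorm (c *: y) = c ^+ 2 * sqnorm y.
  by rewrite /sqnorm mulr_sumr; apply: eq_bigr => i _; rewrite !mxE exprMn.
move=> y; have := sqnorm_ge0 y; rewrite le0r => /orP[/eqP y0|y0].
  by rewrite y0 mulr0 (sqnorm_eq0 y0) -(scale0r (0 : 'rV_n.+1)) quadZ expr0n mul0r.
have c2 : (Num.sqrt (sqnorm y))^-1 ^+ 2 = (sqnorm y)^-1 by rewrite exprVn sqr_sqrtr // ltW.
have Sy : S ((Num.sqrt (sqnorm y))^-1 *: y) by rewrite /S /= sqZ c2 mulVf // gt_eqF.
have := xmax _ (mem_set Sy); rewrite quadZ c2 => h.
by rewrite -ler_pdivrMr // mulrC.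
Qed.

(** For a nonnegative matrix, taking absolute values of the entries of a Rayleigh maximiser does not
    lower the form. The result [z] is again a maximiser, hence an eigenvector, and the maximum it
    attains must be [l]. *)
Lemma perron (R : realType) n (A : 'M[R]_n) l :
  (forall i j, A i j = A j i) -> (forall i j, 0 <= A i j) ->
  largest_eigenvalue A l ->
  (forall y, quad A y <= l * sqnorm y) /\
  exists x : 'rV[R]_n, [/\ x != 0, forall i, 0 <= x 0 i & x *m A = l *: x].
Proof.
move=> Asym Apos [/eigenvalueP[v vA v0] lmax].
case: n A v Asym Apos vA v0 lmax => [|n] A v Asym Apos vA v0 lmax.
  by case/eqP: v0; apply/rowP => -[].
have [x x1 xmax] := quad_max_ex A.
pose z : 'rV[R]_n.+1 := \row_i `|x 0 i|.
have z1 : sqnorm z = 1.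
  by rewrite -x1 /sqnorm; apply: eq_bigr => i _; rewrite mxE real_normK ?num_real.
have zx : quad A x <= quad A z.
  apply: ler_sum => i _; apply: ler_sum => j _; rewrite !mxE ler_wpM2l //.
  by rewrite -normrM ler_norm.
have zA : z *m A = quad A x *: z.
  by apply: maximizer_eigen => //; rewrite z1 mulr1.
have z0 : z != 0.
  apply: contra_eq_neq z1 => ->; rewrite /sqnorm big1 ?(eq_sym 0) ?oner_eq0 // => i _.
  by rewrite mxE expr0n.
have lE : l = quad A x.
  apply/eqP; rewrite eq_le lmax ?andbT; last by apply/eigenvalueP; exists z.
  have s0 : 0 < sqnorm v.
    rewrite lt_neqAle sqnorm_ge0 andbT eq_sym.
    by apply: contra v0 => /eqP/sqnorm_eq0 ->.
  by rewrite -(ler_pM2r s0) -(quad_eigen vA).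
by rewrite lE; split=> //; exists z; split=> // i; rewrite mxE.
Qed.

Close Scope classical_set_scope.

(** * Degrees in the complement when the eigenvalue is at least n - 2 *)

Definition cograph n (G : rel 'I_n) : rel 'I_n := fun i j => (i != j) && ~~ G i j.

Lemma cograph_sym n (G : rel 'I_n) : symmetric G -> symmetric (cograph G).
Proof. by move=> Gs i j; rewrite /cograph Gs eq_sym. Qed.

Lemma cograph_irr n (G : rel 'I_n) : irreflexive (cograph G).
Proof. by move=> i; rewrite /cograph eqxx. Qed.

Lemma deg_cograph n (G : rel 'I_n) v : irreflexive G ->
  (deg (cograph G) v + deg G v = n - 1)%N.
Proof.
move=> Girr; rewrite subn1 -[in RHS](card_ord n) -(cardsC1 v) /deg -cardsUI.
rewrite [X in (_ + X)%N]eq_card0 ?addn0; last by move=> w; rewrite !inE /cograph; case: (G v w); rewrite ?andbF.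
apply: eq_card => w; rewrite !inE /cograph eq_sym.
by case: (altP (w =P v)) => [->|_] /=; [rewrite Girr | case: (G v w)].
Qed.

Lemma natr_deg (R : realType) n (F : rel 'I_n) v :
  \sum_w ((F v w)%:R : R) = (deg F v)%:R.
Proof.
rewrite -natr_sum; congr (_%:R); rewrite /deg -sum1_card [RHS]big_mkcond.
by apply: eq_bigr => w _; rewrite inE; case: (F v w).
Qed.

(** With [N = l + 1] and [S] the entry sum of the Perron vector, the eigenvalue equation is
    [N x_u = S - (F x)_u] ([E1]). It gives [N x_u <= S] ([E2]), and inserting this into [E1] gives
    [N^2 x_w >= S (N - d w)] ([E3]). Weighting [E3] by [d w] and summing yields [E4], which is the
    claim when [N = n - 1]. *)
Lemma degree_product_sum (R : realType) n (G : rel 'I_n) (l : R) :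
  (1 < n)%N -> simple_graph G -> largest_eigenvalue (adjmx R G) l ->
  n%:R - 2 <= l ->
  (\sum_v deg (cograph G) v * (n - 1 - deg (cograph G) v) <= (n - 1) ^ 2)%N.
Proof.
move=> n1 [Gsym Girr] Gl ln; set F := cograph G.
have [||_ [x [x0 xpos xA]]] := perron _ _ Gl.
- by move=> i j; rewrite !mxE Gsym.
- by move=> i j; rewrite mxE ler0n.
have Fsym : symmetric F by exact: cograph_sym.
have [S SE] : exists S, S = \sum_i x 0 i by exists (\sum_i x 0 i).
pose N := l + 1.
have S0 : 0 < S.
  rewrite SE lt_neqAle sumr_ge0 // andbT eq_sym; apply: contra x0.
  rewrite psumr_eq0 // => /allP h; apply/eqP/rowP => i; rewrite mxE.
  by apply/eqP; apply: (h i); rewrite mem_index_enum.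
have E1 u : N * x 0 u = S - \sum_w (F u w)%:R * x 0 w.
  have := congr1 (fun M : 'rV_n => M 0 u) xA; rewrite !mxE => h.
  rewrite mulrDl -h mul1r SE -sumrB.
  have -> : x 0 u = \sum_i (i == u)%:R * x 0 i.
    by rewrite (bigD1 u) //= eqxx mul1r big1 ?addr0 // => i /negbTE ->; rewrite mul0r.
  rewrite -big_split /=; apply: eq_bigr => i _; rewrite !mxE /F /cograph Gsym (eq_sym u i).
  by case: (altP (i =P u)) => [->|_]; [rewrite Girr | case: (G u i)]; rewrite /=; ring.
have n2 : 2 <= n%:R :> R by rewrite ler_nat.
have N1 : n%:R - 1 <= N by rewrite /N; lra.
have N0 : 0 < N by lra.
have E2 u : N * x 0 u <= S.
  by rewrite E1 gerBl sumr_ge0 // => i _; rewrite mulr_ge0.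
pose d v : R := (deg F v)%:R.
(* Sum of [E1] over all [u], with the double sum over F exchanged. *)
have sumE : \sum_w d w * x 0 w = (n%:R - N) * S.
  have : N * S = n%:R * S - \sum_w d w * x 0 w.
    rewrite {1}SE mulr_sumr (eq_bigr _ (fun u _ => E1 u)) sumrB sumr_const card_ord mulr_natl.
    congr (_ - _); rewrite exchange_big; apply: eq_bigr => w _.
    rewrite -mulr_suml /d -natr_deg; congr (_ * _).
    by apply: eq_bigr => i _; rewrite Fsym.
  by move=> h; rewrite mulrBl h; ring.
have E3 w : S * (N - d w) <= N ^+ 2 * x 0 w.
  rewrite expr2 -mulrA E1 !mulrBr [S * N]mulrC lerD2l lerN2 mulr_sumr /d -natr_deg mulr_sumr.
  by apply: (@ler_sum R) => v _; rewrite mulrCA [S * _]mulrC ler_wpM2l.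
have E4 : N * (\sum_w d w) - \sum_w d w ^+ 2 <= N ^+ 2 * (n%:R - N).
  rewrite -(ler_pM2r S0).
  have -> : (N * (\sum_w d w) - \sum_w d w ^+ 2) * S = \sum_w d w * (S * (N - d w)).
    by rewrite mulr_sumr -sumrB mulr_suml; apply: eq_bigr => w _; ring.
  rewrite -[leRHS]mulrA -sumE mulr_sumr; apply: (@ler_sum R) => w _.
  by rewrite [leRHS]mulrCA ler_wpM2l // ler0n.
have D2 : 0 <= \sum_w d w ^+ 2 by apply: sumr_ge0 => w _; exact: sqr_ge0.
have D1 : 0 <= \sum_w d w by apply: sumr_ge0 => w _; exact: ler0n.
rewrite -(ler_nat R) natr_sum natrX natrB ?(ltnW n1) //.
have -> : \sum_v (deg F v * (n - 1 - deg F v))%:R =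
    (n%:R - 1) * (\sum_w d w) - \sum_w d w ^+ 2 :> R.
  rewrite mulr_sumr -sumrB; apply: eq_bigr => v _.
  rewrite natrM natrB ?natrB ?(ltnW n1) // /d; first by ring.
  by rewrite -(deg_cograph v Girr) leq_addr.
move: E4 D1 D2; set a := \sum_w d w; set b := \sum_w d w ^+ 2 => E4 D1 D2.
rewrite -(ler_pM2l N0); set m : R := n%:R - 1.
have m1 : 1 <= m by rewrite /m; lra.
have nE : n%:R = m + 1 by rewrite /m; ring.
rewrite nE in E4; have mN : m <= N by [].
(* It remains to pass from [N] to [m = n - 1 <= N]: the terms in [h2] and [h3] are the nonnegative
   corrections in the two identities that follow. *)
have h1 : m * (N * a - b) <= m * (N ^+ 2 * (m + 1 - N)) by rewrite ler_wpM2l //; lra.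
have h2 : 0 <= (N - m) * b by rewrite mulr_ge0 // subr_ge0.
have h3 : 0 <= m * N * ((N - 1) * (N - m)).
  by rewrite !mulr_ge0 //; lra.
have -> : N * (m * a - b) = m * (N * a - b) - (N - m) * b by ring.
have -> : N * m ^+ 2 = m * (N ^+ 2 * (m + 1 - N)) + m * N * ((N - 1) * (N - m)) by ring.
by lra.
Qed.

(** * A lower bound for the extremal graph and positive eigenvectors *)

Lemma Hgraph_sym n m : symmetric (@Hgraph n m).
Proof. by move=> i j; rewrite /Hgraph eq_sym minnC; congr (_ && (_ || _)); exact: andbC. Qed.

(** All vertices but the last form a clique; the Rayleigh quotient of its indicator vector [y] is
    [n - 2]. *)
Lemma Hgraph_eigenvalue_ge (R : realType) n m (l : R) :
  (1 < n)%N -> largest_eigenvalue (adjmx R (@Hgraph n m)) l -> n%:R - 2 <= l.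
Proof.
case: n => [//|[//|p]] _ Hl.
have [||rayleigh _] := perron _ _ Hl.
- by move=> i j; rewrite !mxE Hgraph_sym.
- by move=> i j; rewrite mxE ler0n.
pose y : 'rV[R]_p.+2 := \row_i (i != ord_max)%:R.
have yw (i : 'I_p.+1) : y 0 (widen_ord (leqnSn p.+1) i) = 1.
  by rewrite mxE -val_eqE /= ltn_eqF.
have ym : y 0 ord_max = 0 by rewrite mxE eqxx.
have := rayleigh y; rewrite /sqnorm big_ord_recr /= ym expr0n addr0.
rewrite (eq_bigr (fun=> 1)); last by move=> i _; rewrite yw expr1n.
rewrite sumr_const card_ord /quad big_ord_recr /=.
rewrite [X in _ + X]big1 ?addr0; last by move=> j _; rewrite ym mul0r mulr0.
rewrite (eq_bigr (fun=> p%:R)) => [|i _]; last first.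
  rewrite big_ord_recr /= ym !mulr0 addr0 (bigD1 i) //= mxE /Hgraph eqxx mul0r add0r.
  rewrite (eq_bigr (fun=> 1)) => [|j ji].
    by rewrite sumr_const cardC1 card_ord.
  rewrite mxE !yw !mulr1 /Hgraph (_ : (widen_ord _ i == widen_ord _ j) = (j == i)); last by rewrite eq_sym.
  rewrite ji /=.
  by rewrite !ltn_eqF.
rewrite sumr_const card_ord -[leLHS]mulr_natr ler_pM2r ?ltr0n //.
by rewrite -(natrB _ (n := 2)) // subn2.
Qed.

(** Positivity of an entry spreads along edges, and [z] links any positive entry to all the
    others. *)
Lemma eigenvector_pos (R : realType) n (e : rel 'I_n) (x : 'rV[R]_n) l z :
  symmetric e -> (forall j, j != z -> e z j) -> 0 < l ->
  x != 0 -> (forall i, 0 <= x 0 i) -> x *m adjmx R e = l *: x ->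
  forall i, 0 < x 0 i.
Proof.
move=> esym ez l0 x0 xpos xA.
have step i j : e i j -> 0 < x 0 i -> 0 < x 0 j.
  move=> eij xi; rewrite -(pmulr_rgt0 _ l0).
  have := congr1 (fun M : 'rV_n => M 0 j) xA; rewrite !mxE => <-.
  rewrite (bigD1 i) //= mxE eij mulr1 ltr_pwDl // sumr_ge0 // => u _.
  by rewrite mxE mulr_ge0.
have xz : 0 < x 0 z.
  have [i xi] : exists i, x 0 i != 0.
    by apply/existsP; apply: contraR x0 => /existsPn h; apply/eqP/rowP => i; rewrite mxE; apply/eqP/negPn/h.
  have {}xi : 0 < x 0 i by rewrite lt_neqAle eq_sym xi xpos.
  by case: (altP (i =P z)) xi => [-> //|iz]; apply: step; rewrite esym ez.
by move=> i; case: (altP (i =P z)) => [-> //|iz]; apply: step xz; exact: ez.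
Qed.

(** * Graphs with a vertex of small degree *)

(** The vertices are listed with the neighbours of [v] first and [v] last. The at most [2 * k - 1]
    neighbours then occupy positions that [Hgraph] joins to its last vertex. *)
Lemma relabel_in_Hgraph n (G : rel 'I_n) k v :
  simple_graph G -> (deg G v < 2 * k)%N ->
  exists f : {perm 'I_n}, forall i j, G (f i) (f j) -> @Hgraph n (2 * k) i j.
Proof.
move=> [Gsym Girr] dv; pose A := [set w | G v w].
pose s1 := enum A ++ [seq w <- enum 'I_n | (w \notin A) && (w != v)].
have us : uniq (rcons s1 v).
  rewrite rcons_uniq mem_cat negb_or mem_enum inE Girr mem_filter eqxx andbF /=.
  rewrite cat_uniq enum_uniq filter_uniq ?enum_uniq // andbT /=.
  by apply/hasPn => w; rewrite mem_filter !mem_enum andbT => /andP[].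
have sz : size (rcons s1 v) = n.
  rewrite -[RHS]size_enum_ord; apply: perm_size; apply: uniq_perm; rewrite ?enum_uniq // => w.
  rewrite mem_rcons in_cons mem_cat [w \in enum A]mem_enum mem_filter !mem_enum.
  by case: (w == v); case: (w \in A).
have [f fE] := perm_of_uniq v us; rewrite sz in fE.
exists f; suff H (i j : 'I_n) : (i : nat) = n.-1 -> G (f i) (f j) -> (j < (2 * k).-1)%N.
  move=> i j Gij; have ij : i != j by apply: contraTneq Gij => ->; rewrite Girr.
  rewrite /Hgraph ij /=; case: (altP ((i : nat) =P n.-1)) => [i1|_] /=.
    by rewrite gtn_min (H i j) ?orbT.
  case: (altP ((j : nat) =P n.-1)) => [j1|//] /=.
  by rewrite gtn_min (H j i) // Gsym.
move=> i1; rewrite !fE // i1 -[in X in nth v _ X]sz nth_last last_rcons => Gvj.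
suff : (j < #|A|)%N by move: dv; rewrite /deg -/A; lia.
rewrite ltnNge; apply/negP => Aj.
have jA : nth v (rcons s1 v) j \in A by rewrite inE.
have : index (nth v (rcons s1 v) j) (rcons s1 v) = j by rewrite index_uniq ?sz.
move: (nth _ _ _) jA => w wA.
rewrite -cats1 -catA index_cat mem_enum wA => jE.
by have := wA; rewrite -mem_enum -index_mem jE -cardE ltnNge Aj.
Qed.

Lemma sub_Hgraph_le (R : realType) n (G : rel 'I_n) k (f : {perm 'I_n}) (lG lH : R) :
  (0 < k)%N -> (2 < n)%N -> simple_graph G ->
  (forall i j, G (f i) (f j) -> @Hgraph n (2 * k) i j) ->
  largest_eigenvalue (adjmx R G) lG ->
  largest_eigenvalue (adjmx R (@Hgraph n (2 * k))) lH ->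
  lG <= lH /\ (lG = lH -> graph_iso G (@Hgraph n (2 * k))).
Proof.
move=> k0 n2 [Gsym Girr] fP Gl Hl; set H := @Hgraph n (2 * k) in fP Hl *.
have [||_ [x [x0 xpos xA]]] := perron _ _ Gl.
- by move=> i j; rewrite !mxE Gsym.
- by move=> i j; rewrite mxE ler0n.
have Hsym : forall i j, adjmx R H i j = adjmx R H j i by move=> i j; rewrite !mxE /H Hgraph_sym.
have [//||rayleigh _] := perron _ _ Hl; first by move=> i j; rewrite mxE ler0n.
(* [y] is the Perron vector of G read in the labelling [f]; its entries are nonnegative, so
   additional edges can only increase the form. *)
pose y : 'rV[R]_n := \row_i x 0 (f i).
have sy : sqnorm y = sqnorm x.
  rewrite /sqnorm [RHS](reindex_inj (@perm_inj _ f)) /=.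
  by apply: eq_bigr => i _; rewrite mxE.
have qy : quad (adjmx R (fun i j => G (f i) (f j))) y = lG * sqnorm y.
  rewrite sy -(quad_eigen xA) /quad [RHS](reindex_inj (@perm_inj _ f)) /=.
  apply: eq_bigr => i _; rewrite [RHS](reindex_inj (@perm_inj _ f)) /=.
  by apply: eq_bigr => j _; rewrite !mxE.
have ypos i : 0 <= y 0 i by rewrite mxE.
have term i j : adjmx R (fun i j => G (f i) (f j)) i j * (y 0 i * y 0 j) <=
    adjmx R H i j * (y 0 i * y 0 j).
  rewrite ler_wpM2r ?mulr_ge0 // !mxE ler_nat; have := fP i j.
  by case: (G _ _) => // ->.
have qH : lG * sqnorm y <= quad (adjmx R H) y.
  by rewrite -qy; apply: (@ler_sum R) => i _; apply: ler_sum => j _; exact: term.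
have sy0 : 0 < sqnorm y.
  rewrite sy lt_neqAle sqnorm_ge0 andbT eq_sym.
  by apply: contra x0 => /eqP/sqnorm_eq0 ->.
split; first by rewrite -(ler_pM2r sy0) (le_trans qH).
move=> lE; have yA : y *m adjmx R H = lH *: y.
  by apply: maximizer_eigen => //; rewrite -lE.
have lH0 : 0 < lH.
  have := Hgraph_eigenvalue_ge (ltnW n2) Hl; apply: lt_le_trans.
  by rewrite subr_gt0 ltr_nat.
have y0 : y != 0.
  by apply: contraTneq sy0 => ->; rewrite /sqnorm big1 ?ltxx // => i _; rewrite mxE expr0n.
have n0 : (0 < n)%N by apply: ltn_trans n2.
have yp : forall i, 0 < y 0 i.
  (* Vertex 0 is adjacent to all others in [H], because [(2 * k).-1] is positive. *)
  apply: (@eigenvector_pos R n H y lH (Ordinal n0)) => //; first exact: Hgraph_sym.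
  by move=> j; rewrite eq_sym /H /Hgraph => -> /=; rewrite min0n; apply/orP; right; lia.
have Geq i j : G (f i) (f j) = H i j.
  have tot : quad (adjmx R H) y = quad (adjmx R (fun i j => G (f i) (f j))) y.
    by apply/eqP; rewrite eq_le {1}qy lE rayleigh qy qH.
  apply/idP/idP; first exact: fP.
  move=> Hij; apply/negPn/negP => nG.
  (* An edge of [H] missing from G would cost the positive amount [y_i y_j]. *)
  have : quad (adjmx R (fun i j => G (f i) (f j))) y < quad (adjmx R H) y.
    rewrite /quad (bigD1 i) //= [ltRHS](bigD1 i) //= ltr_leD //; last first.
      by apply: (@ler_sum R) => u _; apply: ler_sum => w _; exact: term.
    rewrite (bigD1 j) //= [ltRHS](bigD1 j) //= ltr_leD //; last first.
      by apply: (@ler_sum R) => w _; exact: term.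
    by rewrite ltr_pM2r ?mulr_gt0 // !mxE (negbTE nG) Hij ltr01.
  by rewrite tot ltxx.
exists (f^-1)%g; split; first by exists f; [exact: permKV | exact: permK].
by move=> i j; rewrite -Geq !permKV.
Qed.

(** * Invariance of the largest eigenvalue under isomorphism *)

Lemma graph_iso_sym n (G H : rel 'I_n) : graph_iso G H -> graph_iso H G.
Proof.
move=> [f [[g fK gK] fP]]; exists g; split; first by exists f.
by move=> i j; rewrite fP !gK.
Qed.

Lemma graph_iso_eigenvalue (R : realType) n (G H : rel 'I_n) (a : R) :
  graph_iso G H -> eigenvalue (adjmx R G) a -> eigenvalue (adjmx R H) a.
Proof.
move=> [f [[g fK gK] fP]] /eigenvalueP[x xA x0]; apply/eigenvalueP.
exists (\row_j x 0 (g j)).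
  apply/rowP => j; have := congr1 (fun M : 'rV_n => M 0 (g j)) xA; rewrite !mxE => <-.
  rewrite (reindex f) /=; last by exists g => i _; [exact: fK | exact: gK].
  by apply: eq_bigr => i _; rewrite !mxE fK fP gK.
apply: contraNneq x0 => y0; apply/eqP/rowP => i.
by have := congr1 (fun M : 'rV_n => M 0 (f i)) y0; rewrite !mxE fK.
Qed.

Lemma graph_iso_largest (R : realType) n (G H : rel 'I_n) (lG lH : R) :
  graph_iso G H -> largest_eigenvalue (adjmx R G) lG ->
  largest_eigenvalue (adjmx R H) lH -> lG = lH.
Proof.
move=> GH [Ga Gm] [Ha Hm]; apply/eqP; rewrite eq_le Hm ?Gm //.
  exact: graph_iso_eigenvalue (graph_iso_sym GH) Ha.
exact: graph_iso_eigenvalue GH Ga.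
Qed.

Close Scope ring_scope.

(** * Choice of the threshold and the case distinction *)

Theorem theorem5p1 :
  forall k : nat, (0 < k)%N ->
  exists n0 : nat, forall n : nat, (maxn ((80 * k) ^ 2) n0 <= n)%N ->
  forall (R : realType) (G : rel 'I_n), simple_graph G ->
  ~ contains_subgraph G (@cycle_pow n k) ->
  forall lG lH : R,
    largest_eigenvalue (adjmx R G) lG ->
    largest_eigenvalue (adjmx R (@Hgraph n (2 * k))) lH ->
    (lG <= lH)%R /\ (lG = lH <-> graph_iso G (@Hgraph n (2 * k))).
Proof.
move=> k k0; pose D := 16 * k.
(* [c1] and [c2] are the bounds on [n] required by [packing_spread], and [c3] is the one required by
   [packing_dominated]. *)
pose c1 := 2 * D * (D ^ 2 + D ^ 2 * (2 * k + 1) * (2 * D ^ 2 + 1)) + 1.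
pose c2 := 2 * (D ^ 2 * (2 * k + 1) + 1 + 2 * k).
pose c3 := 1000 * k + (4 * k + 6) ^ 2 + 8.
exists (c1 + c2 + c3 + 1) => n; rewrite geq_max => /andP[_ nbig] R G sG noC lG lH Gl Hl.
have [nc1 nc2 nc3] : [/\ c1 < n, c2 < n & c3 <= n].
  by move: c1 c2 c3 nbig => a b c; clear; split; lia.
have n8 : 8 <= n by apply: leq_trans nc3; rewrite leq_addl.
have n2 : 2 < n by apply: leq_trans n8.
have [Gsym Girr] := sG.
case: (boolP [exists v, deg G v < 2 * k]) => [/existsP[v dv]|/existsPn mindeg].
  have [f fP] := relabel_in_Hgraph sG dv.
  have [le eq] := sub_Hgraph_le k0 n2 sG fP Gl Hl.
  by split=> //; split=> // /graph_iso_largest; apply.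
(* If [lG < lH], an isomorphism is excluded as it would force equality. Otherwise
   [lG >= lH >= n - 2], and an embedding of the cycle power gives the contradiction. *)
have [lt|ge] := ltP lG lH.
  split; first exact: ltW.
  by split=> [E|/graph_iso_largest]; [rewrite E ltxx in lt | apply].
case: noC; set F := cograph G.
have Fsym : symmetric F by exact: cograph_sym.
have Firr : irreflexive F by exact: cograph_irr.
have sumle : \sum_v deg F v * (n - 1 - deg F v) <= (n - 1) ^ 2.
  apply: degree_product_sum sG Gl _; first exact: ltnW.
  by apply: le_trans ge; apply: Hgraph_eigenvalue_ge Hl; exact: ltnW.
have [f fP] : exists f : {perm 'I_n}, forall i j, cycle_pow k i j -> ~~ F (f i) (f j).
  (* A vertex [u] violating the inequality is F-adjacent to all but a fraction below [1 / D] of the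
     other vertices, so it dominates F. *)
  case: (boolP [forall v, n - 1 <= D * (n - 1 - deg F v)]) => [/forallP gbig|].
    exact: packing_spread gbig sumle.
  rewrite negb_forall => /existsP[u]; rewrite -ltnNge => gu.
  apply: packing_dominated gu sumle => // v.
  by rewrite -(deg_cograph v Girr) leq_add2l leqNgt mindeg.
exists f; split; first exact: perm_inj.
move=> i j cij; have := fP i j cij; rewrite /F /cograph (inj_eq perm_inj).
by case: (altP (i =P j)) cij => [->|_ _] /=; [rewrite cycle_pow_irr | rewrite negbK].
Qed.
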